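(* Let $G$ be an $n$-vertex graph that does not contain the cube $Q$ as a (not necessarily induced) subgraph. Then the number of edges $e(G)$ of $G$ satisfies $$e(G)\leq n^{8/5}+(2n)^{3/2}.$$
   Context: Graphs are finite and simple. The cube $Q$ is the usual $8$-vertex, $3$-regular graph formed by the $12$ edges of the three-dimensional cube (vertices are the $0$-$1$ vectors of length $3$, two adjacent if and only if they differ in exactly one coordinate). *)

(* Defs.v *)
From mathcomp Require Import all_boot.

Set Implicit Arguments.
Unset Strict Implicit.
Unset Printing Implicit Defensive.

Record sgraph := SGraph {
  vertex :> finType;
  adj : rel vertex;
  adj_sym : symmetric adj;
  adj_irrefl : irreflexive adj }.

(* Edges are unordered pairs, so each one is counted once. *)
Definition edges (G : sgraph) : {set {set G}} :=
  [set [set x; y] | x in G, y in adj x].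

Definition num_edges (G : sgraph) : nat := #|edges G|.

(* Not necessarily induced: non-edges of H may be sent to edges of G. *)
Definition contains_subgraph (G H : sgraph) : Prop :=
  exists f : H -> G, injective f /\ forall u v : H, adj u v -> adj (f u) (f v).

Definition cube_vertex := {ffun 'I_3 -> bool}.

Definition cube_adj : rel cube_vertex :=
  fun u v => #|[set i : 'I_3 | u i != v i]| == 1.

Lemma cube_adj_sym : symmetric cube_adj.
Proof.
move=> u v; rewrite /cube_adj; congr (_ == _).
by apply: eq_card => i; rewrite !inE eq_sym.
Qed.

Lemma cube_adj_irrefl : irreflexive cube_adj.
Proof.
move=> u; rewrite /cube_adj; apply/negbTE.
suff -> : [set i : 'I_3 | u i != u i] = set0 by rewrite cards0.
by apply/setP => i; rewrite !inE eqxx.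
Qed.

Definition cube : sgraph := SGraph cube_adj_sym cube_adj_irrefl.

(* Main.v *)
Require Import Defs.
From mathcomp Require Import all_boot all_order all_algebra.
From mathcomp Require Import all_classical all_reals all_analysis.
From mathcomp Require Import ring lra zify.
From mathcomp Require Import fintype finset.

Set Implicit Arguments.
Unset Strict Implicit.
Unset Printing Implicit Defensive.

Import Order.TTheory GRing.Theory Num.Theory.
Local Open Scope ring_scope.

(** Pass to a bipartite subgraph with parts X, Y and e >= e(G)/2 edges.  For x in
    X and y in Y, a hexagon among the edges between N(y) \ x and N(x) \ y would
    form a cube together with x and y, so these edges form a hexagon-free graph.
    By Gyori's theorem a hexagon-free bipartite graph keeps at least half of its
    edges when its four-cycles are suitably destroyed, and a bipartite graph of
    girth at least 8 with parts of sizes m, n has at most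
    (mn)^(2/3) + m + n edges.  Summing over x and y bounds the number of paths
    of length three from X to Y from above; Hoelder's inequality bounds it from
    below by (e - |X| - |Y|)^3 / (|X| |Y|). *)

(** * Cube roots and Hoelder's inequality for three functions *)

Section Cbrt.
Variable R : realType.
Implicit Types x y z : R.

Definition cbrt x : R := x `^ (3%:R^-1).

Lemma cbrt_ge0 x : 0 <= cbrt x.
Proof. exact: powR_ge0. Qed.

Lemma cbrtK x : 0 <= x -> cbrt x ^+ 3 = x.
Proof.
move=> x0; rewrite -powR_mulrn ?cbrt_ge0// /cbrt -powRrM mulVf ?pnatr_eq0//.
by rewrite powRr1.
Qed.

Lemma cbrtM x y : 0 <= x -> 0 <= y -> cbrt (x * y) = cbrt x * cbrt y.
Proof. by move=> x0 y0; rewrite /cbrt powRM. Qed.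

Lemma AMGM3 x y z : 0 <= x -> 0 <= y -> 0 <= z ->
  x * y * z <= (x ^+ 3 + y ^+ 3 + z ^+ 3) / 3%:R.
Proof.
move=> x0 y0 z0; rewrite ler_pdivlMr ?ltr0n// -subr_ge0.
have -> : x ^+ 3 + y ^+ 3 + z ^+ 3 - x * y * z * 3%:R
   = (x + y + z) * ((x - y) ^+ 2 + (y - z) ^+ 2 + (z - x) ^+ 2) / 2%:R by field.
by rewrite divr_ge0 ?ler0n// mulr_ge0// ?addr_ge0// sqr_ge0.
Qed.

(** Divide each function by its 3-norm and apply AM-GM termwise: the three normalised sums of cubes
    are each 1. *)
Lemma hoelder3 (I : finType) (P : pred I) (u v w : I -> R) :
  (forall i, P i -> 0 <= u i) -> (forall i, P i -> 0 <= v i) ->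
  (forall i, P i -> 0 <= w i) ->
  (\sum_(i | P i) u i * v i * w i) ^+ 3 <=
  (\sum_(i | P i) u i ^+ 3) * (\sum_(i | P i) v i ^+ 3)
    * (\sum_(i | P i) w i ^+ 3).
Proof.
move=> u0 v0 w0.
have s0 (f : I -> R) : (forall i, P i -> 0 <= f i) -> 0 <= \sum_(i | P i) f i ^+ 3.
  by move=> f0; apply: sumr_ge0 => i Pi; rewrite exprn_ge0 ?f0.
have := s0 _ u0; have := s0 _ v0; have := s0 _ w0 => W0 V0 U0.
rewrite -[X in X * _ * _]cbrtK// -[X in _ * X * _]cbrtK// -[X in _ * _ * X]cbrtK//.
set U := cbrt _; set V := cbrt _; set W := cbrt _.
have sum0 (f : I -> R) : (forall i, P i -> 0 <= f i) -> cbrt (\sum_(i | P i) f i ^+ 3) = 0 ->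
    forall i, P i -> f i = 0.
  move=> f0 /(congr1 (fun x => x ^+ 3)); rewrite cbrtK ?s0// expr0n/=.
  move=> Z i Pi; apply/eqP.
  suff : f i ^+ 3 == 0 by rewrite expf_eq0.
  apply/eqP/(psumr_eq0P _ Z) => // j Pj.
  by rewrite exprn_ge0 ?f0.
(* Degenerate case: a vanishing norm forces the function, hence the left side, to vanish. *)
have sE (Z : \sum_(i | P i) u i * v i * w i = 0) :
    (\sum_(i | P i) u i * v i * w i) ^+ 3 <= U ^+ 3 * V ^+ 3 * W ^+ 3.
  by rewrite Z expr0n/= -!exprMn exprn_ge0// !mulr_ge0// cbrt_ge0.
have [/sum0 E|Un0] := eqVneq U 0.
  by apply: sE; rewrite big1// => i Pi; rewrite E// !mul0r.
have [/sum0 E|Vn0] := eqVneq V 0.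
  by apply: sE; rewrite big1// => i Pi; rewrite E// mulr0 mul0r.
have [/sum0 E|Wn0] := eqVneq W 0.
  by apply: sE; rewrite big1// => i Pi; rewrite E// mulr0.
have Up : 0 < U by rewrite lt_def Un0 cbrt_ge0.
have Vp : 0 < V by rewrite lt_def Vn0 cbrt_ge0.
have Wp : 0 < W by rewrite lt_def Wn0 cbrt_ge0.
rewrite -!exprMn lerXn2r ?nnegrE//.
- by apply: sumr_ge0 => i Pi; rewrite !mulr_ge0 ?u0 ?v0 ?w0.
- by rewrite !mulr_ge0 ?cbrt_ge0.
rewrite -[leRHS]mul1r -ler_pdivrMr ?mulr_gt0// mulr_suml.
apply: (@le_trans _ _ (\sum_(i | P i)
   ((u i / U) ^+ 3 + (v i / V) ^+ 3 + (w i / W) ^+ 3) / 3%:R)).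
  apply: ler_sum => i Pi.
  have -> : u i * v i * w i / (U * V * W) = (u i / U) * (v i / V) * (w i / W).
    by field; rewrite Un0 Vn0 Wn0.
  by rewrite AMGM3// divr_ge0 ?u0 ?v0 ?w0// ltW.
have nE (f : I -> R) c : 0 <= \sum_(i | P i) f i ^+ 3 -> c = cbrt (\sum_(i | P i) f i ^+ 3) ->
    c != 0 -> \sum_(i | P i) (f i / c) ^+ 3 = 1.
  move=> f0 cE c0; under eq_bigr do rewrite expr_div_n.
  by rewrite -mulr_suml cE cbrtK// divff// -[X in X != _]cbrtK// -cE expf_neq0.
rewrite -mulr_suml !big_split/= (nE u U)// (nE v V)// (nE w W)//.
by lra.
Qed.

End Cbrt.

(** * Bipartite edge sets and their paths of length three *)

Section Bipartite.
Variables (T1 T2 : finType).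
Implicit Types (E : {set T1 * T2}) (X : {set T1}) (Y : {set T2}).

Definition nbr1 E a := [set b | (a, b) \in E].
Definition nbr2 E b := [set a | (a, b) \in E].

(* The middle edges of the paths of length three from x to y. *)
Definition mid E x y := [set p in E |
  [&& (x, p.2) \in E, (p.1, y) \in E, p.1 != x & p.2 != y]].

Definition C4free E := forall a a' b b', a != a' -> b != b' ->
  (a, b) \in E -> (a, b') \in E -> (a', b) \in E -> (a', b') \in E -> False.

Definition C6free E := forall a1 a2 a3 b1 b2 b3,
  a1 != a2 -> a1 != a3 -> a2 != a3 -> b1 != b2 -> b1 != b3 -> b2 != b3 ->
  (a1, b1) \in E -> (a2, b1) \in E -> (a2, b2) \in E -> (a3, b2) \in E ->
  (a3, b3) \in E -> (a1, b3) \in E -> False.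

(** Double counting of the paths x b a y: a fixed middle edge (a, b) leaves x free in N(b) \ a and y
    free in N(a) \ b. *)
Lemma sum_card_mid E :
  (\sum_x \sum_y #|mid E x y| =
   \sum_(p in E) #|nbr1 E p.1|.-1 * #|nbr2 E p.2|.-1)%N.
Proof.
rewrite pair_big/=.
under eq_bigr do rewrite -sum1_card.
rewrite (exchange_big_dep (mem E))/=; last by move=> q p _; rewrite inE => /andP[].
apply: eq_bigr => -[a b] abE /=.
transitivity #|setX (nbr2 E b :\ a) (nbr1 E a :\ b)|.
  rewrite -sum1_card; apply: eq_bigl => -[x y] /=.
  rewrite !inE/= abE/= ![_ == a]eq_sym ![_ == b]eq_sym.
  by case: (a != x); case: (b != y); rewrite ?andbT ?andbF//= andbC.
rewrite cardsX mulnC.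
by rewrite (cardsD1 a (nbr2 _ _)) (cardsD1 b (nbr1 _ _)) !inE abE.
Qed.

(** Two middle edges with a common end close a four-cycle with x or with y; two disjoint ones close
    the hexagon x b a y a' b'. *)
Lemma card_mid_le1 E x y : C4free E -> C6free E -> (#|mid E x y| <= 1)%N.
Proof.
move=> h4 h6; apply/card_le1_eqP => -[a b] [a' b'].
rewrite !inE/= => /andP[abE /and4P[xb ay ax by_]] /andP[abE' /and4P[xb' ay' ax' by']].
have [ea|na] := eqVneq a a'; have [eb|nb] := eqVneq b b'.
- by rewrite ea eb.
- exfalso; subst a'.
  by apply: (h4 x a b b') => //; rewrite eq_sym.
- exfalso; subst b'.
  exact: (h4 a a' b y).
- exfalso; apply: (h6 x a a' b y b') => //; rewrite eq_sym//.
Qed.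

Lemma mid_sub E x y : mid E x y \subset setX (nbr2 E y) (nbr1 E x).
Proof. by apply/subsetP => p; rewrite !inE => /and5P[_ -> ->]. Qed.

(** * Destroying the four-cycles of a hexagon-free bipartite graph *)

Section Gyori.
Variables (E : {set T1 * T2}) (h6 : C6free E).

Definition quad a a' b b' := [&& a != a', b != b', (a, b) \in E, (a, b') \in E,
  (a', b) \in E & (a', b') \in E].
(** Thick four-cycles are those lying in a K_{2,3} whose side of size two is {b, b'}. *)
Definition thick a a' b b' :=
  [exists c, [&& c != a, c != a', (c, b) \in E & (c, b') \in E]].
(* An edge (a, b) in a four-cycle a b a' b' is deleted when a' < a and the cycle
   is thin, or when b' < b and it is thick; the deleted edge is linked to the
   kept edge (a', b), respectively (a, b'). *)
Definition linked (p q : T1 * T2) :=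
  ((p.2 == q.2) && [exists b', [&& quad q.1 p.1 q.2 b',
     ~~ thick q.1 p.1 q.2 b' & (enum_rank q.1 < enum_rank p.1)%N]]) ||
  ((p.1 == q.1) && [exists a', [&& quad q.1 a' q.2 p.2,
     thick q.1 a' q.2 p.2 & (enum_rank q.2 < enum_rank p.2)%N]]).
Definition deleted := [set p in E | [exists q, linked p q]].

Lemma quadCl a a' b b' : quad a a' b b' = quad a' a b b'.
Proof.
rewrite /quad eq_sym; congr andb; congr andb.
by rewrite andbA andbC -!andbA.
Qed.

Lemma quadCr a a' b b' : quad a a' b b' = quad a a' b' b.
Proof.
rewrite /quad [b == b']eq_sym; congr andb; congr andb.
by rewrite andbCA; do 2 congr andb; rewrite andbC.
Qed.

Lemma thickCl a a' b b' : thick a a' b b' = thick a' a b b'.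
Proof. by rewrite /thick; apply: eq_existsb => c; rewrite andbCA. Qed.

Lemma thickCr a a' b b' : thick a a' b b' = thick a a' b' b.
Proof.
by rewrite /thick; apply: eq_existsb => c; do 2 congr andb; rewrite andbC.
Qed.

(** Otherwise a b1 a1 b a2 b2 would be a hexagon. *)
Lemma quad_share a a1 a2 b b1 b2 : quad a a1 b b1 -> quad a a2 b b2 ->
  a1 = a2 \/ b1 = b2.
Proof.
move=> /and5P[aa1 bb1 ab ab1 /andP[a1b a1b1]] /and5P[aa2 bb2 _ ab2 /andP[a2b a2b2]].
have [?|a12] := eqVneq a1 a2; first by left.
have [?|b12] := eqVneq b1 b2; first by right.
exfalso; apply: (h6 (a1 := a) (a2 := a1) (a3 := a2) (b1 := b1) (b2 := b) (b3 := b2));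
  rewrite // eq_sym//.
Qed.

(** If a2 differed from a1, [quad_share] would give b2 = b1, and a2 would be a third common
    neighbour making the first cycle thick. *)
Lemma thin_line a a1 a2 b b1 b2 : quad a a1 b b1 -> ~~ thick a a1 b b1 ->
  quad a a2 b b2 -> a2 = a1.
Proof.
move=> q1 thin q2; apply/eqP/negP => /negP a21.
have [E12|E12] := quad_share q1 q2; first by rewrite E12 eqxx in a21.
subst b2; move/negP: thin; apply; apply/existsP; exists a2.
by case/and5P: q2 => aa2 _ _ _ /andP[-> ->]; rewrite a21 eq_sym aa2.
Qed.

(** A third common neighbour c gives a second four-cycle through (a, b). If b2 differed from b1,
    [quad_share] applied to both cycles would force a2 = a1 and a2 = c. *)
Lemma thick_line a a1 a2 b b1 b2 : quad a a1 b b1 -> thick a a1 b b1 ->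
  quad a a2 b b2 -> b2 = b1.
Proof.
move=> q1 /existsP[c /and4P[ca ca1 cb cb1]] q2.
have qc : quad a c b b1.
  by case/and5P: q1 => _ bb1 ab ab1 _; rewrite /quad eq_sym ca bb1 ab ab1 cb cb1.
have [E1|//] := quad_share q1 q2; have [E2|//] := quad_share qc q2.
by rewrite E1 E2 eqxx in ca1.
Qed.

(** Thickness is a property of the edge (a, b): a thick and a thin cycle through it would coincide
    by the two preceding lemmas. *)
Lemma thick_edge a a1 a2 b b1 b2 : quad a a1 b b1 -> quad a a2 b b2 ->
  thick a a1 b b1 -> thick a a2 b b2.
Proof.
move=> q1 q2 h; apply: contraT => h2.
move: (h2); rewrite -(thin_line q2 h2 q1) (thick_line q1 h q2).
by rewrite h.
Qed.

(** All four-cycles through q have the same type, and that type determines the end of p outside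
    q. *)
Lemma linked_inj p p' q : linked p q -> linked p' q -> p = p'.
Proof.
case: p p' q => [a b] [c d] [x y]; rewrite /linked/=.
case/orP => /andP[/eqP->] /existsP[u /and3P[q1 t1 _]];
case/orP => /andP[/eqP->] /existsP[v /and3P[q2 t2 _]].
- by rewrite (thin_line q1 t1 q2).
- by rewrite (thick_edge q2 q1 t2) in t1.
- by rewrite (thick_edge q1 q2 t1) in t2.
- by rewrite (thick_line q1 t1 q2).
Qed.

(** If q were linked to some r in turn, the uniqueness of the opposite vertex would give r = p,
    against the strict rank order. *)
Lemma linked_kept p q : linked p q -> q \in E :\: deleted.
Proof.
move=> pq; rewrite !inE.
have qE : q \in E.
  case: p q pq => [a b] [x y]; rewrite /linked/=.
  by case/orP => /andP[_] /existsP[u /and3P[/and5P[_ _ ? _ _] _ _]].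
rewrite qE andbT /=; apply/existsP => -[r]; move: pq.
case: p q r {qE} => [a b] [x y] [c d]; rewrite /linked/=.
case/orP => /andP[/eqP E1] /existsP[u /and3P[q1 t1 l1]];
case/orP => /andP[/eqP E2] /existsP[v /and3P[q2 t2 l2]]; subst.
- rewrite quadCl in q2; rewrite (thin_line q1 t1 q2) in l2.
  by move: (ltn_trans l1 l2); rewrite ltnn.
- by rewrite quadCr in q2; rewrite thickCr in t2; rewrite (thick_edge q2 q1 t2) in t1.
- by rewrite quadCl in q2; rewrite thickCl in t2; rewrite (thick_edge q1 q2 t1) in t2.
- rewrite quadCr in q2; rewrite (thick_line q1 t1 q2) in l2.
  by move: (ltn_trans l1 l2); rewrite ltnn.
Qed.

(** Every four-cycle of E loses an edge: one at its T2-vertex of larger rank if it is thick, at its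
    T1-vertex of larger rank if it is thin. *)
Lemma Gyori_C4free : C4free (E :\: deleted).
Proof.
have lt_wlog (T : finType) (a a' : T) : a != a' ->
    (enum_rank a < enum_rank a')%N \/ (enum_rank a' < enum_rank a)%N.
  move=> aa'; case: (ltngtP (enum_rank a) (enum_rank a')) => [||/val_inj/enum_rank_inj e].
  - by left.
  - by right.
  - by rewrite e eqxx in aa'.
move=> a a' b b' aa' bb' /setDP[ab nab] /setDP[ab' nab'] /setDP[a'b na'b] /setDP[a'b' na'b'].
have nl p q : p \in E -> p \notin deleted -> ~~ linked p q.
  by rewrite inE => -> /= /existsPn.
have Q : quad a a' b b' by rewrite /quad aa' bb' ab ab' a'b a'b'.
case: (boolP (thick a a' b b')) => h.
- have [l|l] := lt_wlog _ _ _ bb'.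
  + move/negP: (nl _ (a, b) ab' nab'); apply; rewrite /linked/= eqxx orbC/=.
    by apply/orP; left; apply/existsP; exists a'; rewrite Q h.
  + move/negP: (nl _ (a, b') ab nab); apply; rewrite /linked/= eqxx orbC/=.
    by apply/orP; left; apply/existsP; exists a'; rewrite quadCr Q thickCr h.
- have [l|l] := lt_wlog _ _ _ aa'.
  + move/negP: (nl _ (a, b) a'b na'b); apply; rewrite /linked/= eqxx /=.
    by apply/orP; left; apply/existsP; exists b'; rewrite Q h.
  + move/negP: (nl _ (a', b) ab nab); apply; rewrite /linked/= eqxx /=.
    by apply/orP; left; apply/existsP; exists b'; rewrite quadCl Q thickCl h.
Qed.

Lemma Gyori_half : (#|E| <= 2 * #|E :\: deleted|)%N.
Proof.
(* [f] injects deleted edges into kept ones; the default [p] is never reached on [deleted]. *)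
pose f p := odflt p [pick q | linked p q].
have fP p : p \in deleted -> linked p (f p).
  rewrite inE => /andP[_ /existsP[q pq]]; rewrite /f.
  by case: pickP => //= /(_ q); rewrite pq.
have sub : deleted \subset E by apply/subsetP => p; rewrite inE => /andP[].
have : (#|deleted| <= #|E :\: deleted|)%N.
  rewrite -(card_in_imset (f := f)).
    by apply/subset_leq_card/subsetP => _ /imsetP[p /fP/linked_kept h ->].
  move=> p p' /fP h /fP h' e; rewrite e in h; exact: linked_inj h h'.
by rewrite -(cardsID deleted E) (setIidPr sub); lia.
Qed.

End Gyori.

Lemma C4free_half E : C6free E -> exists E' : {set T1 * T2},
  [/\ E' \subset E, C4free E' & (#|E| <= 2 * #|E'|)%N].
Proof.
move=> h6; exists (E :\: deleted E); split; first exact: subsetDl.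
- exact: Gyori_C4free.
- exact: Gyori_half.
Qed.

End Bipartite.

(** * Edge bounds from counting paths of length three *)

Section Paths.
Variables (R : realType) (T1 T2 : finType).
Implicit Types (E : {set T1 * T2}) (X : {set T1}) (Y : {set T2}).

Lemma sum_edges1 (V : nmodType) E (F : T1 * T2 -> V) :
  \sum_(p in E) F p = \sum_a \sum_(b in nbr1 E a) F (a, b).
Proof.
rewrite pair_big_dep /=.
by apply: eq_big => [[a b]|[a b] _]; rewrite ?inE.
Qed.

Lemma sum_edges2 (V : nmodType) E (F : T1 * T2 -> V) :
  \sum_(p in E) F p = \sum_b \sum_(a in nbr2 E b) F (a, b).
Proof.
rewrite sum_edges1 (exchange_big_dep xpredT)//=.
by apply: eq_bigr => b _; apply: eq_bigl => a; rewrite !inE.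
Qed.

Lemma card_edges1 E : \sum_a #|nbr1 E a|%:R = #|E|%:R :> R.
Proof.
rewrite -sum1_card natr_sum sum_edges1; apply: eq_bigr => a _.
by rewrite sumr_const.
Qed.

Lemma card_edges2 E : \sum_b #|nbr2 E b|%:R = #|E|%:R :> R.
Proof.
rewrite -sum1_card natr_sum sum_edges2; apply: eq_bigr => b _.
by rewrite sumr_const.
Qed.

Lemma nbr1_out E X Y a : E \subset setX X Y -> a \notin X -> #|nbr1 E a| = 0%N.
Proof.
move=> /subsetP sE aX; apply/eqP; rewrite cards_eq0 -subset0.
by apply/subsetP => b; rewrite inE => /sE; rewrite inE (negPf aX).
Qed.

Lemma nbr2_out E X Y b : E \subset setX X Y -> b \notin Y -> #|nbr2 E b| = 0%N.
Proof.
move=> /subsetP sE bY; apply/eqP; rewrite cards_eq0 -subset0.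
by apply/subsetP => a; rewrite inE => /sE; rewrite inE (negPf bY) andbF.
Qed.

Lemma sum_out (V : nmodType) (T : finType) (X : {set T}) (F : T -> V) :
  (forall a, a \notin X -> F a = 0) -> \sum_a F a = \sum_(a in X) F a.
Proof.
move=> h; rewrite [RHS]big_mkcond; apply: eq_bigr => a _.
by case: ifPn => // /h.
Qed.

(** A vertex of positive degree contributes 1, an isolated one 0. This bounds the sum of 1/d over
    the edges. *)
Lemma sum_divff_le (T : finType) (X : {set T}) (d : T -> nat) :
  (forall a, a \notin X -> d a = 0%N) ->
  \sum_a (d a)%:R^-1 *+ d a <= #|X|%:R :> R.
Proof.
move=> h; rewrite (sum_out (X := X)) => [|a /h ->]; last by rewrite mulr0n.
rewrite -sum1_card natr_sum; apply: ler_sum => a _.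
rewrite -[leLHS]mulr_natr; have [->|n0] := eqVneq (d a) 0%N; first by rewrite mulr0.
by rewrite mulVf// pnatr_eq0.
Qed.

Lemma cbrt_ge_id (x : R) : 0 <= x <= 1 -> x <= cbrt x.
Proof.
move=> /andP[x0 x1]; have c0 := cbrt_ge0 x.
have c1 : cbrt x <= 1 by rewrite -(@ler_pXn2r _ 3) ?nnegrE// cbrtK// expr1n.
rewrite -[leLHS]cbrtK//; nra.
Qed.

Lemma sum_card_midX E X Y : E \subset setX X Y ->
  (\sum_x \sum_y #|mid E x y| = \sum_(x in X) \sum_(y in Y) #|mid E x y|)%N.
Proof.
move=> sE.
have h x y : (x \notin X) || (y \notin Y) -> #|mid E x y| = 0%N.
  move=> xy; have := subset_leq_card (mid_sub E x y).
  rewrite cardsX; case/orP: xy => [xX|yY].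
    by rewrite (nbr1_out sE xX) muln0 leqn0 => /eqP.
  by rewrite (nbr2_out sE yY) leqn0 => /eqP.
rewrite [LHS](sum_out (V := nat) (X := X)) => [|x xX]; last first.
  by rewrite big1// => y _; rewrite h ?xX.
apply: eq_bigr => x _; rewrite [LHS](sum_out (V := nat) (X := Y))// => y yY.
by rewrite h// yY orbT.
Qed.

(* Hoelder's inequality applied to
   ((d-1)(d'-1) / (d d'))^(1/3) >= 1 - 1/d - 1/d' on each edge. *)
Lemma sum_mid_ge E X Y : E \subset setX X Y -> (#|X| + #|Y| <= #|E|)%N ->
  (#|E|%:R - #|X|%:R - #|Y|%:R) ^+ 3 <=
    (\sum_x \sum_y #|mid E x y|)%N%:R * #|X|%:R * #|Y|%:R :> R.
Proof.
move=> sE le.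
pose d1 (p : T1 * T2) : R := #|nbr1 E p.1|%:R.
pose d2 (p : T1 * T2) : R := #|nbr2 E p.2|%:R.
have n1 p : p \in E -> (0 < #|nbr1 E p.1|)%N.
  by move=> pE; apply/card_gt0P; exists p.2; rewrite inE -surjective_pairing.
have n2 p : p \in E -> (0 < #|nbr2 E p.2|)%N.
  by move=> pE; apply/card_gt0P; exists p.1; rewrite inE -surjective_pairing.
have h1 p : p \in E -> 1 <= d1 p by move=> /n1; rewrite /d1 ler1n.
have h2 p : p \in E -> 1 <= d2 p by move=> /n2; rewrite /d2 ler1n.
have S1 : \sum_(p in E) (d1 p)^-1 <= #|X|%:R.
  rewrite sum_edges1 /d1/=.
  under eq_bigr do rewrite sumr_const.
  by apply: sum_divff_le => a; exact: nbr1_out sE.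
have S2 : \sum_(p in E) (d2 p)^-1 <= #|Y|%:R.
  rewrite sum_edges2 /d2/=.
  under eq_bigr do rewrite sumr_const.
  by apply: sum_divff_le => a; exact: nbr2_out sE.
(* The cubes of these three functions sum to the number of paths, to at most |X|, and to at most
   |Y|. *)
have := @hoelder3 R _ (mem E) (fun p => cbrt ((d1 p - 1) * (d2 p - 1)))
  (fun p => cbrt (d1 p)^-1) (fun p => cbrt (d2 p)^-1)
  (fun _ _ => cbrt_ge0 _) (fun _ _ => cbrt_ge0 _) (fun _ _ => cbrt_ge0 _).
set L := (X in X ^+ 3 <= _) => H.
have Lge : #|E|%:R - #|X|%:R - #|Y|%:R <= L.
  apply: (@le_trans _ _ (\sum_(p in E) (1 - (d1 p)^-1 - (d2 p)^-1))).
    rewrite !big_split/= !sumrN sumr_const.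
    by rewrite !lerB.
  apply: ler_sum => p pE; have {}h1 := h1 p pE; have {}h2 := h2 p pE.
  have i1 : 0 <= (d1 p)^-1 <= 1.
    by rewrite invr_ge0 invf_le1 ?h1 ?andbT ?(le_trans _ h1) ?(lt_le_trans _ h1).
  have i2 : 0 <= (d2 p)^-1 <= 1.
    by rewrite invr_ge0 invf_le1 ?h2 ?andbT ?(le_trans _ h2) ?(lt_le_trans _ h2).
  rewrite -!cbrtM ?mulr_ge0 ?subr_ge0 ?(andP i1).1 ?(andP i2).1//.
  have -> : (d1 p - 1) * (d2 p - 1) * (d1 p)^-1 * (d2 p)^-1 =
      (1 - (d1 p)^-1) * (1 - (d2 p)^-1).
    by field; rewrite !gt_eqF ?(lt_le_trans _ h1) ?(lt_le_trans _ h2).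
  move: i1 i2; set x := _^-1; set y := _^-1 => /andP[x0 x1] /andP[y0 y1].
  (* (1 - x)(1 - y) is at least 1 - x - y and, lying in [0, 1], at most its own cube root. *)
  apply: le_trans (cbrt_ge_id _); first by nra.
  by rewrite mulr_ge0 ?subr_ge0//= mulr_ile1 ?subr_ge0// lerBlDr lerDl.
apply: le_trans (_ : L ^+ 3 <= _).
  have e0 : 0 <= #|E|%:R - #|X|%:R - #|Y|%:R :> R.
    by rewrite -addrA -opprD subr_ge0 -natrD ler_nat.
  by rewrite lerXn2r ?nnegrE// (le_trans e0).
apply: le_trans H _.
have i0 (f : T1 * T2 -> R) : (forall p, p \in E -> 1 <= f p) ->
    forall p, p \in E -> cbrt (f p)^-1 ^+ 3 = (f p)^-1.
  by move=> h p pE; rewrite cbrtK// invr_ge0 (le_trans _ (h p pE)).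
rewrite (eq_bigr _ (i0 _ h1)) (eq_bigr _ (i0 _ h2)).
have -> : \sum_(p in E) cbrt ((d1 p - 1) * (d2 p - 1)) ^+ 3 =
    (\sum_x \sum_y #|mid E x y|)%N%:R.
  rewrite sum_card_mid natr_sum; apply: eq_bigr => p pE.
  rewrite cbrtK ?mulr_ge0 ?subr_ge0 ?h1 ?h2//.
  by rewrite natrM -!subn1 !natrB ?n1 ?n2.
have t0 (f : T1 * T2 -> R) : (forall p, p \in E -> 1 <= f p) ->
    0 <= \sum_(p in E) (f p)^-1.
  by move=> h; apply: sumr_ge0 => p /h h'; rewrite invr_ge0 (le_trans _ h').
by rewrite ler_pM// ?mulr_ge0 ?t0 ?ler0n// ler_wpM2l.
Qed.

(** With at most one path of length three per pair (x, y), [sum_mid_ge] gives (e - m - n)^3 <=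
    (mn)^2. For e < m + n the bound is trivial. *)
Lemma C4free_C6free_card E X Y : E \subset setX X Y -> C4free E -> C6free E ->
  #|E|%:R <= cbrt (#|X|%:R * #|Y|%:R) ^+ 2 + (#|X|%:R + #|Y|%:R) :> R.
Proof.
move=> sE h4 h6.
have [lt|le] := ltnP #|E| (#|X| + #|Y|).
  apply: (@le_trans _ _ (#|X|%:R + #|Y|%:R)); last by rewrite lerDr exprn_ge0 ?cbrt_ge0.
  by rewrite -natrD ler_nat ltnW.
have := sum_mid_ge sE le.
have mid1 : (\sum_x \sum_y #|mid E x y| <= #|X| * #|Y|)%N.
  rewrite (sum_card_midX sE) -sum_nat_const; apply: leq_sum => x _.
  by rewrite -sum1_card; apply: leq_sum => y _; exact: card_mid_le1.
set s := (\sum_x _)%N in mid1 *; set m : R := #|X|%:R; set n : R := #|Y|%:R => h.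
have m0 : 0 <= m by exact: ler0n.
have n0 : 0 <= n by exact: ler0n.
have mn0 : 0 <= m * n by exact: mulr_ge0.
rewrite -lerBlDr opprD addrA -(@ler_pXn2r _ 3)//.
- rewrite -exprM mulnC exprM cbrtK//; apply: le_trans h _.
  by rewrite -mulrA expr2 ler_wpM2r// -natrM ler_nat.
- by rewrite nnegrE -addrA -opprD subr_ge0 -natrD ler_nat.
- by rewrite nnegrE exprn_ge0// cbrt_ge0.
Qed.

Lemma C6free_card E X Y : E \subset setX X Y -> C6free E ->
  #|E|%:R <= 2%:R * (cbrt (#|X|%:R * #|Y|%:R) ^+ 2 + (#|X|%:R + #|Y|%:R)) :> R.
Proof.
move=> sE h6; have [E' [E'E h4 le]] := C4free_half h6.
apply: (@le_trans _ _ (2%:R * #|E'|%:R)); first by rewrite -natrM ler_nat.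
rewrite ler_wpM2l//; apply: C4free_C6free_card h4 _; first exact: subset_trans sE.
move=> a1 a2 a3 b1 b2 b3 ? ? ? ? ? ? /(subsetP E'E)? /(subsetP E'E)?.
move=> /(subsetP E'E)? /(subsetP E'E)? /(subsetP E'E)? /(subsetP E'E)?.
exact: (h6 a1 a2 a3 b1 b2 b3).
Qed.

(** Hoelder with exponents 3 and 3/2, obtained from the three functions 1, d^(1/3), d^(1/3). *)
Lemma sum_cbrt2_le (T : finType) (A : {set T}) (d : T -> R) :
  (forall x, x \in A -> 0 <= d x) ->
  \sum_(x in A) cbrt (d x) ^+ 2 <= cbrt #|A|%:R * cbrt (\sum_(x in A) d x) ^+ 2.
Proof.
move=> d0; have s0 : 0 <= \sum_(x in A) d x by exact: sumr_ge0.
rewrite -(@ler_pXn2r _ 3) ?nnegrE//; last 2 first.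
- by apply: sumr_ge0 => x _; rewrite exprn_ge0 ?cbrt_ge0.
- by rewrite mulr_ge0 ?exprn_ge0 ?cbrt_ge0.
have := @hoelder3 R _ (mem A) (fun _ => 1) (@cbrt R \o d) (@cbrt R \o d)
  (fun _ _ => ler01) (fun _ _ => cbrt_ge0 _) (fun _ _ => cbrt_ge0 _).
have E : \sum_(i in A) (@cbrt R \o d) i ^+ 3 = \sum_(x in A) d x.
  by apply: eq_bigr => x xA /=; rewrite cbrtK ?d0.
rewrite E.
under eq_bigr do rewrite mul1r -expr2.
under [X in X * _ * _]eq_bigr do rewrite expr1n.
move/le_trans; apply.
by rewrite sumr_const exprMn -exprM mulnC exprM !cbrtK// -mulrA -expr2.
Qed.

(** [mid E x y] lies between N(y) and N(x), so [C6free_card] bounds it in terms of the degrees.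
    Summed over all pairs, the 2/3-powers factor into two sums handled by [sum_cbrt2_le], and the
    linear terms give e(m + n). *)
Lemma locally_C6free_card E X Y : E \subset setX X Y ->
  (forall x y, x \in X -> y \in Y -> C6free (mid E x y)) ->
  (#|X| + #|Y| <= #|E|)%N ->
  (#|E|%:R - #|X|%:R - #|Y|%:R) ^+ 3 <=
    2%:R * (cbrt (#|X|%:R * #|Y|%:R) * cbrt #|E|%:R ^+ 4
      + #|E|%:R * (#|X|%:R + #|Y|%:R)) * (#|X|%:R * #|Y|%:R) :> R.
Proof.
move=> sE h6 le; apply: le_trans (sum_mid_ge sE le) _.
set m : R := #|X|%:R; set n : R := #|Y|%:R; set e : R := #|E|%:R.
rewrite -[leLHS]mulrA ler_wpM2r ?mulr_ge0 ?ler0n//.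
rewrite (sum_card_midX sE) natr_sum.
pose d1 x : R := #|nbr1 E x|%:R; pose d2 y : R := #|nbr2 E y|%:R.
have d10 x : 0 <= d1 x by exact: ler0n.
have d20 y : 0 <= d2 y by exact: ler0n.
have s1 : \sum_(x in X) d1 x = e.
  rewrite /e -card_edges1 (sum_out (X := X))// => a aX.
  by rewrite (nbr1_out sE aX).
have s2 : \sum_(y in Y) d2 y = e.
  rewrite /e -card_edges2 (sum_out (X := Y))// => a aX.
  by rewrite (nbr2_out sE aX).
apply: (@le_trans _ _ (\sum_(x in X) \sum_(y in Y) 2%:R *
   (cbrt (d1 x) ^+ 2 * cbrt (d2 y) ^+ 2 + (d1 x + d2 y)))).
  apply: ler_sum => x xX; rewrite natr_sum; apply: ler_sum => y yY.
  apply: le_trans (C6free_card (mid_sub E x y) (h6 x y xX yY)) _.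
  by rewrite -/(d1 x) -/(d2 y) -exprMn -cbrtM// [d2 y * _]mulrC [d2 y + _]addrC.
have -> : \sum_(x in X) \sum_(y in Y) 2%:R *
   (cbrt (d1 x) ^+ 2 * cbrt (d2 y) ^+ 2 + (d1 x + d2 y)) =
   2%:R * ((\sum_(x in X) cbrt (d1 x) ^+ 2) * (\sum_(y in Y) cbrt (d2 y) ^+ 2)
     + e * (m + n)).
  under eq_bigr do rewrite -mulr_sumr big_split/= -mulr_sumr big_split/= sumr_const.
  rewrite -mulr_sumr big_split/= -mulr_suml big_split/= s2 sumr_const.
  rewrite sumrMnl s1 -(mulr_natr e #|X|) -(mulr_natr e #|Y|) -/m -/n.
  by congr (_ * (_ + _)); rewrite addrC mulrDr.
rewrite ler_wpM2l// lerD2r.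
apply: (@le_trans _ _ ((cbrt m * cbrt e ^+ 2) * (cbrt n * cbrt e ^+ 2))).
  apply: ler_pM; try by apply: sumr_ge0 => *; rewrite exprn_ge0 ?cbrt_ge0.
  - by rewrite -s1 sum_cbrt2_le.
  - by rewrite -s2 sum_cbrt2_le.
by rewrite cbrtM ?ler0n// mulrACA -exprD.
Qed.

End Paths.

(** * A cut containing at least half of the edges *)

Section Cut.
Variable T : finType.

(** Adding x injects the 2^(|T| - 2) subsets of the complement of {x, y} into the family. *)
Lemma card_separating (x y : T) : x != y ->
  (2 ^ #|T| <= 4 * #|[set S : {set T} | (x \in S) && (y \notin S)]|)%N.
Proof.
move=> xy; have c2 : (#|~: [set x; y]| + 2 = #|T|)%N.
  by rewrite -(cardsC [set x; y]) cards2 xy addnC.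
rewrite -c2 expnD mulnC leq_mul2l /= -card_powerset.
rewrite -(card_in_imset (f := fun Z => x |: Z)) => [|Z Z']; last first.
  rewrite !powersetE => /subsetP ZS /subsetP ZS' eZ.
  have xN (W : {set T}) : {subset W <= ~: [set x; y]} -> W = (x |: W) :\ x.
    by move=> h; rewrite setU1K//; apply/negP => /h; rewrite !inE eqxx.
  by rewrite (xN Z)// (xN Z')// eZ.
apply/subset_leq_card/subsetP => _ /imsetP[Z + ->].
rewrite powersetE => /subsetP ZS; rewrite !inE eqxx /= eq_sym (negPf xy)/=.
by apply/negP => /ZS; rewrite !inE eqxx orbT.
Qed.

(** Listing the end in S first turns the crossing edges of a graph into a bipartite edge set, each
    taken once. *)
Definition cut (e : rel T) (S : {set T}) : {set T * T} :=
  [set p in setX S (~: S) | e p.1 p.2].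

(** Each ordered pair is cut by at least a quarter of all sets, so a maximum cut reaches this
    average. *)
Lemma exists_half_cut (e : rel T) : irreflexive e ->
  exists S, (#|[set p : T * T | e p.1 p.2]| <= 4 * #|cut e S|)%N.
Proof.
move=> irr; set D := [set p | _].
have [S _ maxS] := @arg_maxnP _ set0 xpredT (fun S => #|cut e S|) isT.
exists S.
have : (#|D| * 2 ^ #|T| <= 4 * \sum_(Z : {set T}) #|cut e Z|)%N.
  have -> : (\sum_(Z : {set T}) #|cut e Z| =
      \sum_(p in D) #|[set Z : {set T} | (p.1 \in Z) && (p.2 \notin Z)]|)%N.
    transitivity (\sum_(Z : {set T}) \sum_(p in cut e Z) 1)%N.
      by apply: eq_bigr => Z _; rewrite sum1_card.
    rewrite (exchange_big_dep (mem D))/=; last first.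
      by move=> Z p _; rewrite !inE => /andP[].
    apply: eq_bigr => p; rewrite inE => ep; rewrite -sum1_card.
    by apply: eq_bigl => Z; rewrite !inE ep andbT.
  rewrite big_distrr/= -sum_nat_const; apply: leq_sum => -[x y].
  rewrite inE/= => exy; apply: card_separating.
  by apply: contraTneq exy => ->; rewrite irr.
have le : (\sum_(Z : {set T}) #|cut e Z| <= 2 ^ #|T| * #|cut e S|)%N.
  have <- : #|{set T}| = (2 ^ #|T|)%N.
    by rewrite -[#|T|]cardsT -card_powerset powersetT cardsT.
  by rewrite -sum_nat_const; apply: leq_sum => Z _; exact: maxS.
move=> h; rewrite -(leq_pmul2l (expn_gt0 2 #|T|)) mulnC.
by apply: leq_trans h _; rewrite mulnCA leq_mul2l.
Qed.

End Cut.

(** Each edge {x, y} accounts for the two ordered pairs (x, y) and (y, x), which turns the factor 4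
    into 2. *)
Lemma num_edges_half_cut (G : sgraph) :
  exists S : {set G}, (num_edges G <= 2 * #|cut (@adj G) S|)%N.
Proof.
have [S le] := exists_half_cut (@adj_irrefl G); exists S.
rewrite -(leq_pmul2l (isT : 0 < 2)%N) mulnA; apply: leq_trans le.
set D := [set p | _].
rewrite -[X in (_ <= X)%N]sum1_card.
rewrite (partition_big (fun p : G * G => [set p.1; p.2]) (mem (edges G)))/=; last first.
  by move=> [x y]; rewrite inE => /= xy; apply: imset2_f.
rewrite mulnC -sum_nat_const; apply: leq_sum => _ /imset2P[x y _ xy0 ->].
have xy : adj x y := xy0.
have ne : (x, y) != (y, x).
  apply: contraTneq xy => -[-> _].
  by rewrite adj_irrefl.
rewrite (bigD1 (x, y)) ?inE//=; last by rewrite eqxx andbT.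
rewrite (bigD1 (y, x)) ?inE//=.
by rewrite adj_sym xy setUC eqxx eq_sym.
Qed.

(** * Building a cube from a hexagon and two further vertices *)

Lemma cube_adjE (u v : cube_vertex) (i0 := inord 0 : 'I_3) (i1 := inord 1 : 'I_3)
    (i2 := inord 2 : 'I_3) :
  cube_adj u v = ((u i0 != v i0) + (u i1 != v i1) + (u i2 != v i2) == 1)%N.
Proof.
rewrite /cube_adj -sum1_card big_mkcond /= !big_ord_recl big_ord0 !inE.
have -> : lift ord0 (lift ord0 ord0) = i2 by apply/val_inj; rewrite /= inordK.
have -> : lift ord0 ord0 = i1 by apply/val_inj; rewrite /= inordK.
have -> : ord0 = i0 by apply/val_inj; rewrite /= inordK.
by do 3 case: (_ != _).
Qed.

(** Deleting two antipodal vertices of the cube leaves a hexagon whose vertices are joined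
    alternately to the one and the other. Here x is joined to all b's and y to all a's. *)
Lemma cube_free_mid (G : sgraph) (S : {set G}) x y :
  ~ contains_subgraph G cube -> x \in S -> y \notin S ->
  C6free (mid (cut (@adj G) S) x y).
Proof.
move=> cf xS yS a1 a2 a3 b1 b2 b3 a12 a13 a23 b12 b13 b23.
rewrite !inE/= => /andP[/andP[/andP[a1S b1S] e11] /and4P[/andP[_ xb1] /andP[_ a1y] a1x b1y]].
move=> /andP[/andP[/andP[a2S _] e21] /and4P[_ /andP[_ a2y] a2x _]].
move=> /andP[/andP[/andP[_ b2S] e22] /and4P[/andP[_ xb2] _ _ b2y]].
move=> /andP[/andP[/andP[a3S _] e32] /and4P[_ /andP[_ a3y] a3x _]].
move=> /andP[/andP[/andP[_ b3S] e33] /and4P[/andP[_ xb3] _ _ b3y]].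
move=> /andP[/andP[_ e13] _].
apply: cf.
have SN a b : a \in S -> b \notin S -> a != b.
  by move=> aS; apply: contraNneq => <-.
pose i0 := inord 0 : 'I_3; pose i1 := inord 1 : 'I_3; pose i2 := inord 2 : 'I_3.
(* Positions are cube vertices read in binary: x at 0, the b's at 1, 2, 4, each a at the sum of the
   positions of its two hexagon neighbours, y at 7. *)
pose s := [:: x; b1; b2; a2; b3; a1; a3; y].
pose idx (u : cube_vertex) := (u i0 + (u i1).*2 + (u i2).*2.*2)%N.
have us : uniq s.
  rewrite /s /= !inE !negb_or; do !(apply/andP; split);
  by [|rewrite eq_sym|apply: SN|rewrite eq_sym SN].
have idx8 u : (idx u < size s)%N by rewrite /idx /=; do 3 case: (u _).
exists (fun u : cube => nth x s (idx u)); split.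
  move=> u v /eqP; rewrite nth_uniq// => /eqP uv.
  suff [e0 [e1 e2]] : u i0 = v i0 /\ u i1 = v i1 /\ u i2 = v i2.
    apply/ffunP => -[[|[|[|//]]] i3].
    - by have -> : Ordinal i3 = i0 by apply/val_inj; rewrite /= inordK.
    - by have -> : Ordinal i3 = i1 by apply/val_inj; rewrite /= inordK.
    - by have -> : Ordinal i3 = i2 by apply/val_inj; rewrite /= inordK.
  by move: uv; rewrite /idx;
    move: (u i0) (u i1) (u i2) (v i0) (v i1) (v i2); do 6 case.
move=> u v; rewrite /= cube_adjE -/i0 -/i1 -/i2 /idx.
case: (u i0); case: (u i1); case: (u i2); case: (v i0); case: (v i1); case: (v i2);
by [|move=> _ /=; rewrite adj_sym].
Qed.

(** * Solving the inequality for the number of edges *)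

Section Numeric.
Variable R : realType.

(* Here [t] and [a] stand for the cube roots of the number of edges and of
   [N `^ (8 / 5) / 2]. *)
Lemma edge_equation_bound (t a q N : R) : 0 <= t -> 0 <= a -> 0 <= q -> 0 <= N ->
  q ^+ 2 = 2%:R * N ^+ 3 -> t ^+ 3 <= N ^+ 2 / 4%:R -> N <= t ^+ 3 ->
  (t ^+ 3 - N) ^+ 3 <= a ^+ 5 * t ^+ 4 + N ^+ 3 / 2%:R * t ^+ 3 ->
  t ^+ 3 <= a ^+ 3 + q.
Proof.
move=> t0 a0 q0 N0 qE tN Nt h; rewrite leNgt; apply/negP => lt.
have a3 : 0 <= a ^+ 3 by rewrite exprn_ge0.
move eE : (t ^+ 3) tN Nt h lt => e tN Nt h lt.
have qe : q < e by lra.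
have N2 : 0 <= N ^+ 2 by rewrite sqr_ge0.
have N32 : 32%:R <= N.
  rewrite leNgt; apply/negP => N32.
  have : e ^+ 2 <= 2%:R * N ^+ 3.
    apply: (@le_trans _ _ ((N ^+ 2 / 4%:R) ^+ 2)); first by rewrite lerXn2r ?nnegrE//; lra.
    have -> : (N ^+ 2 / 4%:R) ^+ 2 = N ^+ 3 * (N / 16%:R) by field.
    by rewrite [leRHS]mulrC ler_wpM2l ?exprn_ge0//; lra.
  rewrite -qE ler_pXn2r ?nnegrE//; lra.
have q8 : 8%:R * N <= q.
  rewrite -(@ler_pXn2r _ 2) ?nnegrE ?mulr_ge0// qE.
  have -> : (8%:R * N) ^+ 2 = 64%:R * N ^+ 2 by ring.
  have -> : 2%:R * N ^+ 3 = (2%:R * N) * N ^+ 2 by ring.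
  by rewrite ler_wpM2r ?sqr_ge0//; lra.
have e0 : 0 < e by exact: le_lt_trans qe.
have at_ : a <= t.
  by rewrite -(@ler_pXn2r _ 3) ?nnegrE// eE; lra.
have a5 : a ^+ 5 * t <= a ^+ 3 * e.
  have -> : a ^+ 5 * t = a ^+ 3 * (a ^+ 2 * t) by ring.
  by rewrite ler_wpM2l// -eE (exprSr t 2) ler_wpM2r// lerXn2r ?nnegrE//.
(* The hypothesis divided by e = t^3, after dropping N^2 (3e - N) >= 0 from (e - N)^3. *)
have h' : e ^+ 2 - 3%:R * e * N <= a ^+ 5 * t + q ^+ 2 / 4%:R.
  rewrite -(ler_pM2r e0) qE.
  apply: (@le_trans _ _ ((e - N) ^+ 3)).
    rewrite -subr_ge0.
    have -> : (e - N) ^+ 3 - (e ^+ 2 - 3%:R * e * N) * e = N ^+ 2 * (3%:R * e - N) by ring.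
    by rewrite mulr_ge0 ?sqr_ge0//; lra.
  apply: le_trans h _.
  rewrite le_eqVlt; apply/orP; left; apply/eqP.
  by rewrite -eE; field.
have : e * (a ^+ 3 + q) <= a ^+ 3 * e + q ^+ 2 / 4%:R + 3%:R * e * N.
  apply: (@le_trans _ _ (e ^+ 2)); last by lra.
  by rewrite expr2 ler_wpM2l ?ltW.
(* Cancelling a^3 e leaves e q <= q^2 / 4 + 3 e N, but q < e and 8N <= q make the right side at most
   5 e q / 8. *)
by nra.
Qed.

(** By mn <= N^2 / 4 this reduces to [edge_equation_bound] with a^3 = N^(8/5) / 2 and q = (2N)^(3/2)
    / 2, the halves coming from the factor 2 before e. *)
Lemma two_edges_bound (N m n e : R) : 0 <= m -> 0 <= n -> N = m + n ->
  0 <= e -> e <= m * n -> N <= e ->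
  (e - m - n) ^+ 3 <= 2%:R * (cbrt (m * n) * cbrt e ^+ 4 + e * (m + n)) * (m * n) ->
  2%:R * e <= N `^ (8 / 5) + (2 * N) `^ (3 / 2).
Proof.
move=> m0 n0 NE e0 emn Ne h.
have N0 : 0 <= N by lra.
have mnN : m * n <= N ^+ 2 / 4%:R by rewrite NE; have := sqr_ge0 (m - n); nra.
set P := N `^ _; set Q := (2 * N) `^ _.
have P0 : 0 <= P / 2%:R by rewrite divr_ge0// powR_ge0.
have PE : P ^+ 5 = N ^+ 8.
  rewrite -powR_mulrn ?powR_ge0// -powRrM divfK ?pnatr_eq0//.
  by rewrite powR_mulrn.
have QE : Q ^+ 2 = (2 * N) ^+ 3.
  rewrite -powR_mulrn ?powR_ge0// -powRrM divfK ?pnatr_eq0//.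
  by rewrite powR_mulrn// mulr_ge0.
have k0 := cbrt_ge0 (m * n).
have kE : cbrt (m * n) ^+ 3 = m * n by rewrite cbrtK// mulr_ge0.
have t0 := cbrt_ge0 e.
have tE := cbrtK e0.
have a0 := cbrt_ge0 (P / 2%:R).
have aE := cbrtK P0.
set k := cbrt (m * n) in h k0 kE; set t := cbrt e in h t0 tE.
set a := cbrt (P / 2%:R) in a0 aE.
(* Compare cubes: 8 (mn)^4 <= 8 (N^2 / 4)^4 = N^8 / 32 = a^15. *)
have ka : 2%:R * k ^+ 4 <= a ^+ 5.
  rewrite -(@ler_pXn2r _ 3) ?nnegrE ?mulr_ge0 ?exprn_ge0//.
  have -> : (a ^+ 5) ^+ 3 = N ^+ 8 / 32%:R.
    by rewrite -exprM mulnC exprM aE expr_div_n PE -natrX.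
  have -> : (2%:R * k ^+ 4) ^+ 3 = 8%:R * (m * n) ^+ 4 by rewrite -kE; ring.
  have -> : N ^+ 8 / 32%:R = 8%:R * (N ^+ 2 / 4%:R) ^+ 4 by field.
  by rewrite ler_wpM2l// lerXn2r ?nnegrE ?mulr_ge0//; apply: le_trans mnN; exact: mulr_ge0.
suff : t ^+ 3 <= a ^+ 3 + Q / 2%:R by rewrite tE aE; lra.
apply: (edge_equation_bound (N := N)); rewrite ?divr_ge0 ?powR_ge0 ?tE//.
- by rewrite expr_div_n QE; field.
- exact: le_trans mnN.
have -> : e - N = e - m - n by rewrite NE; ring.
apply: le_trans h _; rewrite -NE mulrDr mulrDl lerD//.
  have -> : 2%:R * (k * t ^+ 4) * (m * n) = 2%:R * k ^+ 4 * t ^+ 4.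
    by rewrite -kE; ring.
  by rewrite ler_wpM2r ?exprn_ge0.
have -> : 2%:R * (e * N) * (m * n) = (2%:R * e * N) * (m * n) by ring.
have -> : N ^+ 3 / 2%:R * e = (2%:R * e * N) * (N ^+ 2 / 4%:R) by field.
by rewrite ler_wpM2l// !mulr_ge0.
Qed.

End Numeric.

Theorem mainTheorem1 (R : realType) (n : nat) (G : sgraph)
    (hn : #|G| = n) (hQ : ~ contains_subgraph G cube) :
  (num_edges G)%:R <= n%:R `^ (8 / 5) + (2 * n%:R) `^ (3 / 2) :> R.
Proof.
have [S le] := num_edges_half_cut G; set E := cut _ S in le.
have sE : E \subset setX S (~: S) by apply/subsetP => p; rewrite inE => /andP[].
have cn : (#|S| + #|~: S| = n)%N by rewrite cardsC.
apply: (@le_trans _ _ (2%:R * #|E|%:R)); first by rewrite -natrM ler_nat.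
have [lt|ge] := ltnP #|E| n; last first.
  apply: (@two_edges_bound _ _ #|S|%:R #|~: S|%:R); rewrite ?ler0n ?ler_nat//.
  - by rewrite -natrD cn.
  - by rewrite -natrM ler_nat -cardsX subset_leq_card.
  - apply: (locally_C6free_card R sE); last by rewrite cn.
    by move=> x y xS; rewrite inE => yS; apply: cube_free_mid.
(* With fewer than n cut edges, 2 |E| <= 2n <= (2n)^(3/2) already suffices. *)
have n1 : (1 <= n)%N by exact: leq_ltn_trans lt.
have n1R : 1 <= n%:R :> R by rewrite ler1n.
apply: (@le_trans _ _ ((2 * n%:R) `^ 1)).
  by rewrite powRr1 ?mulr_ge0// ler_wpM2l// ler_nat ltnW.
apply: (@le_trans _ _ ((2 * n%:R) `^ (3 / 2))); last by rewrite lerDr powR_ge0.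
by rewrite ler_powR//; lra.
Qed.
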